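(* Let $a_0,a_1,a_2,a_3,a_4,b_0,b_1,b_2,b_3,b_4$ be real numbers and suppose the periodic ternary continued fraction $[\{a_0,a_1,\overline{a_2,a_3,a_4}\},\{b_0,b_1,\overline{b_2,b_3,b_4}\}]$ converges to a pair of real numbers $(\alpha,\beta)$. Let $r$ be a nonzero rational number. Then the periodic ternary continued fraction $$\left[\left\{ra_0,ra_1,\overline{\tfrac{a_2}{r^2},ra_3,ra_4}\right\},\left\{\tfrac{b_0}{r},r^2b_1,\overline{\tfrac{b_2}{r},\tfrac{b_3}{r},r^2b_4}\right\}\right]$$ converges to $\left(r\alpha,\frac{\beta}{r}\right)$.
   Context: Ternary continued fractions: for sequences $(a_n)_{n\ge0},(b_n)_{n\ge0}$ of real numbers define $A_n,B_n,C_n$ by $A_n=a_nA_{n-1}+b_nA_{n-2}+A_{n-3}$, $B_n=a_nB_{n-1}+b_nB_{n-2}+B_{n-3}$, $C_n=a_nC_{n-1}+b_nC_{n-2}+C_{n-3}$ for $n\ge1$, with $A_{-2}=1,A_{-1}=0,A_0=a_0$; $B_{-2}=0,B_{-1}=1,B_0=b_0$; $C_{-2}=0,C_{-1}=0,C_0=1$. The fraction $[\{a_0,a_1,\dots\},\{b_0,b_1,\dots\}]$ converges to $(x,y)$ if $A_n/C_n\to x$ and $B_n/C_n\to y$. The notation $[\{a_0,a_1,\overline{a_2,a_3,a_4}\},\{b_0,b_1,\overline{b_2,b_3,b_4}\}]$ denotes the sequences with $a_{3k+2}=a_2,a_{3k+3}=a_3,a_{3k+4}=a_4$ and $b_{3k+2}=b_2,b_{3k+3}=b_3,b_{3k+4}=b_4$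 for all $k\ge0$ (and similarly for the transformed sequences).
   Formalization: The initial values are exchanged to A_{-2}=0, A_{-1}=1 and B_{-2}=1, B_{-1}=0, since with the printed ones the claim fails (all a_n=3, all b_n=-3, r=2: first limit 13/2, not 8); convergence also requires C_n nonzero for all large n. *)

(* Defs.v *)
From mathcomp Require Import all_boot all_order all_algebra.
From mathcomp Require Import all_classical all_reals all_analysis.

Set Implicit Arguments.
Unset Strict Implicit.
Unset Printing Implicit Defensive.

Import Order.TTheory GRing.Theory Num.Theory.
Import numFieldNormedType.Exports.

Local Open Scope classical_set_scope.
Local Open Scope ring_scope.

(* The index is shifted by two: [tcf_rec a b u v w n] is X_(n-2), where
   X_(-2) = u, X_(-1) = v, X_0 = w and
   X_k = a_k X_(k-1) + b_k X_(k-2) + X_(k-3) for k >= 1. *)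
Fixpoint tcf_rec (R : realType) (a b : nat -> R) (u v w : R) (n : nat) : R :=
  match n with
  | 0%N => u
  | 1%N => v
  | 2%N => w
  | S (S (S m as p) as q) =>
      a p * tcf_rec a b u v w q + b p * tcf_rec a b u v w p
      + tcf_rec a b u v w m
  end.

(* The initial values are those of the expansion
     x = a_0 + y_1 / x_1,  y = b_0 + 1 / x_1,
     x_n = a_n + y_(n+1) / x_(n+1),  y_n = b_n + 1 / x_(n+1),
   whose first convergent is (a_0 + b_1 / a_1, b_0 + 1 / a_1).  Hence
   (A_(-2), A_(-1)) = (0, 1) and (B_(-2), B_(-1)) = (1, 0).  The source
   prints these two pairs exchanged; with that convention the recurrences do
   not compute this expansion, and the scaling (x, y) |-> (r x, y / r) fails
   (e.g. r = 2, all a_n = 3, all b_n = -3). *)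
Definition tcfA (R : realType) (a b : nat -> R) (n : nat) : R :=
  tcf_rec a b 0 1 (a 0%N) n.+2.
Definition tcfB (R : realType) (a b : nat -> R) (n : nat) : R :=
  tcf_rec a b 1 0 (b 0%N) n.+2.
Definition tcfC (R : realType) (a b : nat -> R) (n : nat) : R :=
  tcf_rec a b 0 0 1 n.+2.

(* Division is total, so the convergents are required to be eventually
   defined. *)
Definition tcf_cvg (R : realType) (a b : nat -> R) (x y : R) : Prop :=
  [/\ \forall n \near \oo, tcfC a b n != 0,
      (fun n => tcfA a b n / tcfC a b n) @ \oo --> x
    & (fun n => tcfB a b n / tcfC a b n) @ \oo --> y].

Definition periodic23 (R : realType) (x0 x1 x2 x3 x4 : R) (n : nat) : R :=
  match n with
  | 0%N => x0
  | 1%N => x1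
  | S (S m) => nth 0 [:: x2; x3; x4] (m %% 3)
  end.

(* Main.v *)
(** If the recurrence coefficients are changed to [a'_n = (s_n / s_(n-1)) a_n]
    and [b'_n = (s_n / s_(n-2)) b_n], where [s] is nowhere zero and has period
    three, then [s_n X_n] solves the new recurrence whenever [X_n] solves the old
    one; the coefficient of [X_(n-3)] stays 1 because [s_n = s_(n-3)].  The
    transformation of the theorem is the case where [s] cycles through
    [r, 1/r, 1], starting at [n = -2].  Comparing initial values gives
    [A'_n = r s_n A_n], [B'_n = s_n B_n / r] and [C'_n = s_n C_n], so that [s_n]
    cancels in the convergents. *)
Require Import Defs.
From mathcomp Require Import all_boot all_order all_algebra.
From mathcomp Require Import all_classical all_reals all_analysis.
From mathcomp Require Import ring.

Import Order.TTheory GRing.Theory Num.Theory.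
Import numFieldNormedType.Exports.

Local Open Scope ring_scope.

(* The index of [s] is shifted by two, as in [tcf_rec]. *)
Definition tcf_scaling {R : realType} (s a b a' b' : nat -> R) : Prop :=
  forall n, [/\ a' n.+1 * s n.+2 = s n.+3 * a n.+1,
                b' n.+1 * s n.+1 = s n.+3 * b n.+1 & s n.+3 = s n].

(** By linearity a constant [c] can be carried along; it fits the scaling to each triple of initial
    values. *)
Lemma tcf_rec_scale {R : realType} {s a b a' b' : nat -> R} (c u v w : R) :
  tcf_scaling s a b a' b' ->
  forall n, tcf_rec a' b' (c * s 0%N * u) (c * s 1%N * v) (c * s 2%N * w) n
            = c * s n * tcf_rec a b u v w n.
Proof.
move=> sP n.
set T' := tcf_rec a' b' _ _ _; set T := tcf_rec a b u v w.
(* The recurrence has order three, so the induction carries three consecutive terms. *)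
suff [] : [/\ T' n = c * s n * T n, T' n.+1 = c * s n.+1 * T n.+1
            & T' n.+2 = c * s n.+2 * T n.+2] by [].
elim: n => [//|n [IH0 IH1 IH2]]; split => //.
have [ha hb hs] := sP n.
have -> : T' n.+3 = a' n.+1 * T' n.+2 + b' n.+1 * T' n.+1 + T' n by [].
have -> : T n.+3 = a n.+1 * T n.+2 + b n.+1 * T n.+1 + T n by [].
rewrite IH0 IH1 IH2 -hs.
have -> : a' n.+1 * (c * s n.+2 * T n.+2) = c * (a' n.+1 * s n.+2) * T n.+2.
  by ring.
have -> : b' n.+1 * (c * s n.+1 * T n.+1) = c * (b' n.+1 * s n.+1) * T n.+1.
  by ring.
by rewrite ha hb; ring.
Qed.

Definition cycle3 {R : realType} (r : R) (n : nat) : R :=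
  nth 0 [:: r; r^-1; 1] (n %% 3).

Lemma cycle3_neq0 {R : realType} (r : R) (n : nat) : r != 0 -> cycle3 r n != 0.
Proof.
move=> r0; rewrite /cycle3.
by case: (n %% 3)%N (ltn_pmod n (isT : 0 < 3)%N) => [|[|[|]]] //= _;
  rewrite ?invr_eq0 ?oner_eq0.
Qed.

Lemma periodic23_scaling {R : realType} (r : R)
    (a0 a1 a2 a3 a4 b0 b1 b2 b3 b4 : R) : r != 0 ->
  tcf_scaling (cycle3 r)
    (periodic23 a0 a1 a2 a3 a4) (periodic23 b0 b1 b2 b3 b4)
    (periodic23 (r * a0) (r * a1) (a2 / r ^+ 2) (r * a3) (r * a4))
    (periodic23 (b0 / r) (r ^+ 2 * b1) (b2 / r) (b3 / r) (r ^+ 2 * b4)).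
Proof.
(* Coefficient index 1 precedes the period; from index 2 on, everything depends on [n %% 3] only. *)
move=> r0 [|n]; first by rewrite /cycle3 /=; split => //; field.
rewrite /cycle3 /= (divn_eq n 3) -!addnS !modnMDl.
by case: (n %% 3)%N (ltn_pmod n (isT : 0 < 3)%N) => [|[|[|]]] //= _;
  split => //; field.
Qed.

Theorem theorem5 (R : realType) (a0 a1 a2 a3 a4 b0 b1 b2 b3 b4 : R)
    (alpha beta : R) (q : rat) :
  tcf_cvg (periodic23 a0 a1 a2 a3 a4) (periodic23 b0 b1 b2 b3 b4) alpha beta ->
  q != 0 ->
  let r : R := ratr q in
  tcf_cvg
    (periodic23 (r * a0) (r * a1) (a2 / r ^+ 2) (r * a3) (r * a4))
    (periodic23 (b0 / r) (r ^+ 2 * b1) (b2 / r) (b3 / r) (r ^+ 2 * b4))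
    (r * alpha) (beta / r).
Proof.
move=> [C0 cvgA cvgB] q0 r.
have r0 : r != 0 by rewrite fmorph_eq0.
have := periodic23_scaling r a0 a1 a2 a3 a4 b0 b1 b2 b3 b4 r0.
move: C0 cvgA cvgB.
set a := periodic23 a0 _ _ _ _; set b := periodic23 b0 _ _ _ _.
set a' := periodic23 (r * a0) _ _ _ _; set b' := periodic23 (b0 / r) _ _ _ _.
move=> C0 cvgA cvgB sP.
have s0 n : cycle3 r n != 0 by exact: cycle3_neq0.
have eqA n : tcfA a' b' n = r * cycle3 r n.+2 * tcfA a b n.
  (* [c = r] is forced by the initial value 1 at shifted index 1, where [cycle3 r] is [r^-1]. *)
  rewrite /tcfA -(tcf_rec_scale r _ _ _ sP).
  by congr (tcf_rec a' b' _ _ _ _); rewrite /cycle3 /a' /a /=; field.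
have eqB n : tcfB a' b' n = r^-1 * cycle3 r n.+2 * tcfB a b n.
  rewrite /tcfB -(tcf_rec_scale r^-1 _ _ _ sP).
  by congr (tcf_rec a' b' _ _ _ _); rewrite /cycle3 /b' /b /=; field.
have eqC n : tcfC a' b' n = cycle3 r n.+2 * tcfC a b n.
  rewrite /tcfC -[cycle3 r _]mul1r -(tcf_rec_scale 1 _ _ _ sP).
  by congr (tcf_rec a' b' _ _ _ _); rewrite /cycle3 /= ?mulr0 ?mulr1.
(* At [y = 0] both sides are 0, so the convergents can be rewritten at every [n]. *)
have cancel_s (c s x y : R) : s != 0 -> c * s * x / (s * y) = c * (x / y).
  by move=> s_neq0; rewrite -[c * s * x]mulrA -[LHS]mulrA -mulf_div divff // mul1r.
split.
- by apply: filterS C0 => n Cn; rewrite eqC mulf_neq0.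
- under eq_fun do rewrite eqA eqC cancel_s //.
  exact: cvgMr.
- under eq_fun do rewrite eqB eqC cancel_s //.
  rewrite [beta / r]mulrC; exact: cvgMr.
Qed.
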